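(* Let $n\in\{0,1,2,\dots\}$. Then $$\frac{d}{d\delta}\bigl[\ln ME_{n,\delta}\bigr]=-\ln\bigl(s_n(\delta)\bigr),\qquad \delta\in(0,n+1).$$
   Context: For $n\in\{0,1,2,\dots\}$ and $\delta\in(0,n+1)$, $$E_{n,\delta}(s)=\frac{1-\Bigl(1+\frac{s^1}{1!}+\dots+\frac{s^n}{n!}\Bigr)e^{-s}}{s^{\delta}}\quad(s>0),\qquad E_{n,\delta}(0)=0.$$ $s_n(\delta)$ denotes the unique positive solution $s$ of $$e^s=1+\frac{s^1}{1!}+\dots+\frac{s^n}{n!}+\frac{1}{\delta}\,\frac{s^{n+1}}{n!},$$ and $ME_{n,\delta}=\max_{s\ge 0}E_{n,\delta}(s)=E_{n,\delta}(s_n(\delta))$. *)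

(* Defs.v *)
(* Stdlib world: the classical reals [R], with Coquelicot. *)
From Stdlib Require Import Reals Factorial.
From Coquelicot Require Import Coquelicot.
Open Scope R_scope.

(* [sum_f_R0 f n] has the n+1 terms f 0, ..., f n. *)
Definition exp_taylor (n : nat) (s : R) : R :=
  sum_f_R0 (fun k => s ^ k / INR (fact k)) n.

(* The domain is s >= 0. The value 0 at s < 0 is a junk value. *)
Definition E (n : nat) (delta s : R) : R :=
  if Rlt_dec 0 s
  then (1 - exp_taylor n s * exp (- s)) / Rpower s delta
  else 0.

Definition is_s (n : nat) (delta s : R) : Prop :=
  0 < s /\
  exp s = exp_taylor n s + / delta * (s ^ (n + 1) / INR (fact n)).

(* Coquelicot's [iota P] is the x such that [P x] whenever that x exists and
   is unique ([iota_correct]). This is the case for [s_] and [ME] when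
   0 < delta < n + 1. *)
Definition s_ (n : nat) (delta : R) : R := iota (is_s n delta).

Definition is_max_E (n : nat) (delta m : R) : Prop :=
  (exists s, 0 <= s /\ E n delta s = m) /\
  (forall s, 0 <= s -> E n delta s <= m).

Definition ME (n : nat) (delta : R) : R := iota (is_max_E n delta).

(* Main.v *)
Require Import Defs.
From Stdlib Require Import Reals Ranalysis5 Factorial Lra Lia.
From Coquelicot Require Import Coquelicot.
Open Scope R_scope.

(** The proof is an envelope argument.  Write [G s = 1 - T s * exp (- s)],
    where [T] is the Taylor polynomial of [exp] of degree [n].  For [s > 0],
    [ln (E n d s) = ln (G s) - d * ln s] is affine in [d] with slope [- ln s],
    so [ln (ME n d)] is a supremum of affine functions of [d], attained at
    [s_ n d].  Testing the maximum at [d'] with the maximiser at [d], and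
    conversely, encloses the increment of [ln (ME n d)]
    ([ln_ME_tangent]):
    [- (d' - d) * ln (s_ n d) <= ln (ME n d') - ln (ME n d)
       <= - (d' - d) * ln (s_ n d')].
    Continuity of [s_ n] at [d] ([continuous_s]) then gives the derivative
    [- ln (s_ n d)], with no need to differentiate [s_ n] itself.

    It remains to study [s_ n d], which solves [q s = / (d * n!)] for
    [q s = (exp s - T s) / s ^ (n + 1)].  The point is that [q] is strictly
    increasing on the positive reals ([tail_quotient_increasing]): its power
    series has positive coefficients; here this appears as the positivity of
    the numerator of [q'], which vanishes at [0] and whose derivative is the
    same numerator for [n - 1], or [s * exp s] when [n = 0].  Monotonicity
    makes the solution unique, makes it depend continuously on [d], and
    determines the sign of the derivative of [ln (E n d)], so that the solution
    is the maximiser.  Existence follows from the intermediate value theorem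
    and elementary bounds on [q] near [0] and for large [s]. *)

(** * The exponential tail *)

Definition exp_tail (n : nat) (s : R) : R := exp s - exp_taylor n s.

Definition tail_quotient (n : nat) (s : R) : R := exp_tail n s / s ^ (n + 1).

(** The probability that a Poisson variable of mean [s] exceeds [n]. *)
Definition poisson_tail (n : nat) (s : R) : R :=
  1 - exp_taylor n s * exp (- s).

Lemma INR_fact_pos (n : nat) : 0 < INR (fact n).
Proof. apply lt_0_INR, lt_O_fact. Qed.

Lemma INR_fact_S (n : nat) : INR (fact (S n)) = (INR n + 1) * INR (fact n).
Proof. now rewrite fact_simpl, mult_INR, S_INR. Qed.

Lemma exp_taylor_at_0 (n : nat) : exp_taylor n 0 = 1.
Proof.
  induction n as [|n IH]; unfold exp_taylor in *; simpl sum_f_R0.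
  - simpl. field.
  - rewrite IH. pose proof (INR_fact_pos (S n)) as Hf.
    simpl pow. unfold Rdiv. rewrite Rmult_0_l. ring.
Qed.

Lemma exp_taylor_S (n : nat) (s : R) :
  exp_taylor (S n) s = exp_taylor n s + s ^ S n / INR (fact (S n)).
Proof. reflexivity. Qed.

Lemma exp_tail_S (n : nat) (s : R) :
  exp_tail n s = exp_tail (S n) s + s ^ S n / INR (fact (S n)).
Proof. unfold exp_tail. rewrite exp_taylor_S. ring. Qed.

Lemma exp_tail_at_0 (n : nat) : exp_tail n 0 = 0.
Proof. unfold exp_tail. rewrite exp_taylor_at_0, exp_0. ring. Qed.

Lemma is_derive_monomial (n : nat) (s : R) :
  is_derive (fun x => x ^ S n / INR (fact (S n))) s (s ^ n / INR (fact n)).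
Proof.
  pose proof (INR_fact_pos n) as Hf. pose proof (pos_INR n) as Hn.
  rewrite INR_fact_S.
  auto_derive; [trivial|].
  cbn [Init.Nat.pred].
  change (match n with 0%nat => 1 | S _ => INR n + 1 end) with (INR (S n)).
  rewrite S_INR. field. lra.
Qed.

Lemma is_derive_exp_taylor (n : nat) (s : R) :
  is_derive (exp_taylor n) s (exp_taylor n s - s ^ n / INR (fact n)).
Proof.
  induction n as [|n IH].
  - apply (is_derive_ext (fun _ => 1)).
    + intros t. unfold exp_taylor. simpl. field.
    + unfold exp_taylor. simpl. auto_derive; [trivial | field].
  - apply (is_derive_ext
             (fun x => exp_taylor n x + x ^ S n / INR (fact (S n)))).
    + intros t. now rewrite exp_taylor_S.
    + rewrite exp_taylor_S.
      replace (exp_taylor n s + _ - _) with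
        (plus (exp_taylor n s - s ^ n / INR (fact n)) (s ^ n / INR (fact n)))
        by (unfold plus; simpl; ring).
      apply (is_derive_plus (V := R_NormedModule)); [exact IH|].
      apply is_derive_monomial.
Qed.

Lemma is_derive_exp_tail (n : nat) (s : R) :
  is_derive (exp_tail n) s (exp_tail n s + s ^ n / INR (fact n)).
Proof.
  unfold exp_tail.
  replace (_ + _) with
    (minus (exp s) (exp_taylor n s - s ^ n / INR (fact n)))
    by (unfold minus, plus, opp; simpl; ring).
  apply (is_derive_minus (V := R_NormedModule));
    [apply is_derive_exp | apply is_derive_exp_taylor].
Qed.

Lemma lt_of_derive_pos (f df : R -> R) (a b : R) :
  a < b ->
  (forall x, a <= x <= b -> is_derive f x (df x)) ->
  (forall x, a < x < b -> 0 < df x) ->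
  f a < f b.
Proof.
  intros Hab Hf Hdf.
  destruct (MVT_cor2 f df a b Hab) as [c [Heq Hc]].
  - intros c Hc. apply is_derive_Reals. now apply Hf.
  - pose proof (Rmult_lt_0_compat _ (b - a) (Hdf c Hc)). lra.
Qed.

Lemma exp_tail_pos (n : nat) (s : R) : 0 < s -> 0 < exp_tail n s.
Proof.
  revert s. induction n as [|n IH]; intros s Hs.
  - unfold exp_tail, exp_taylor. simpl.
    pose proof (exp_ineq1 s ltac:(lra)). lra.
  - rewrite <- (exp_tail_at_0 (S n)).
    apply (lt_of_derive_pos (exp_tail (S n)) (exp_tail n)); [exact Hs | |].
    + intros x _. rewrite (exp_tail_S n x). apply is_derive_exp_tail.
    + intros x Hx. apply IH. lra.
Qed.

(** * Monotonicity of the tail quotient *)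

(** Numerator of the derivative of [tail_quotient], up to a power of [s].  Since
    differentiation lowers the index of [exp_tail] by one, it also lowers the
    index of this expression by one, which is what makes its positivity
    accessible to induction. *)
Definition quotient_numerator (n : nat) (s : R) : R :=
  (s - (INR n + 1)) * exp_tail n s + s ^ S n / INR (fact n).

Lemma is_derive_quotient_numerator (n : nat) (s : R) :
  is_derive (quotient_numerator n) s
    ((s - INR n) * exp_tail n s + s ^ S n / INR (fact n)).
Proof.
  pose proof (INR_fact_pos n) as Hf.
  pose proof (is_derive_exp_tail n s) as HR.
  unfold quotient_numerator. auto_derive.
  - eexists; exact HR.
  - replace (Derive _ s) with (exp_tail n s + s ^ n / INR (fact n))
      by (symmetry; exact (is_derive_unique _ _ _ HR)).
    change (match n with 0%nat => 1 | S _ => INR n + 1 end) with (INR (S n)).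
    rewrite S_INR. simpl. field. lra.
Qed.

Lemma quotient_numerator_pos (n : nat) (s : R) :
  0 < s -> 0 < quotient_numerator n s.
Proof.
  assert (H0 : forall m, quotient_numerator m 0 = 0).
  { intros m. unfold quotient_numerator. rewrite exp_tail_at_0. simpl.
    unfold Rdiv. ring. }
  revert s. induction n as [|n IH]; intros s Hs.
  - rewrite <- (H0 0%nat).
    apply (lt_of_derive_pos _ _ _ _ Hs
             (fun x _ => is_derive_quotient_numerator 0 x)).
    intros x Hx. pose proof (exp_tail_pos 0 x ltac:(lra)).
    simpl. assert (0 < x * exp_tail 0 x) by (apply Rmult_lt_0_compat; lra). lra.
  - rewrite <- (H0 (S n)).
    apply (lt_of_derive_pos _ _ _ _ Hs
             (fun x _ => is_derive_quotient_numerator (S n) x)).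
    intros x Hx. pose proof (IH x ltac:(lra)) as Hpos.
    unfold quotient_numerator in Hpos. rewrite exp_tail_S in Hpos.
    pose proof (INR_fact_pos n) as Hf. pose proof (pos_INR n) as Hn.
    rewrite INR_fact_S in *. rewrite (S_INR n).
    replace (_ + _) with
      ((x - (INR n + 1))
         * (exp_tail (S n) x + x ^ S n / ((INR n + 1) * INR (fact n)))
       + x ^ S n / INR (fact n)); [exact Hpos|].
    simpl. field. lra.
Qed.

Lemma is_derive_tail_quotient (n : nat) (s : R) : 0 < s ->
  is_derive (tail_quotient n) s (quotient_numerator n s / s ^ (n + 2)).
Proof.
  intros Hs. pose proof (INR_fact_pos n) as Hf.
  pose proof (is_derive_exp_tail n s) as HR.
  assert (Hp : 0 < s ^ n) by now apply pow_lt.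
  unfold tail_quotient, quotient_numerator. auto_derive.
  - repeat split; [eexists; exact HR | apply Rgt_not_eq, pow_lt, Hs].
  - replace (Derive _ s) with (exp_tail n s + s ^ n / INR (fact n))
      by (symmetry; exact (is_derive_unique _ _ _ HR)).
    replace (Init.Nat.pred (n + 1)) with n by lia.
    rewrite plus_INR, !pow_add. simpl. field. lra.
Qed.

Lemma tail_quotient_increasing (n : nat) (s t : R) :
  0 < s -> s < t -> tail_quotient n s < tail_quotient n t.
Proof.
  intros Hs Hst.
  apply (lt_of_derive_pos (tail_quotient n)
           (fun x => quotient_numerator n x / x ^ (n + 2)) s t Hst).
  - intros x Hx. apply is_derive_tail_quotient. lra.
  - intros x Hx. apply Rdiv_lt_0_compat.
    + apply quotient_numerator_pos. lra.
    + apply pow_lt. lra.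
Qed.

(** * The critical point *)

Lemma poisson_tailE (n : nat) (s : R) :
  poisson_tail n s = exp_tail n s * exp (- s).
Proof.
  unfold poisson_tail, exp_tail. rewrite Rmult_minus_distr_r, <- exp_plus.
  replace (s + - s) with 0 by ring. now rewrite exp_0.
Qed.

Lemma poisson_tail_pos (n : nat) (s : R) : 0 < s -> 0 < poisson_tail n s.
Proof.
  intros Hs. rewrite poisson_tailE.
  apply Rmult_lt_0_compat; [now apply exp_tail_pos | apply exp_pos].
Qed.

(** The derivative telescopes to a single term, the Gamma density. *)
Lemma is_derive_poisson_tail (n : nat) (s : R) :
  is_derive (poisson_tail n) s (s ^ n / INR (fact n) * exp (- s)).
Proof.
  pose proof (is_derive_exp_taylor n s) as HT.
  unfold poisson_tail. auto_derive.
  - eexists; exact HT.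
  - replace (Derive _ s) with (exp_taylor n s - s ^ n / INR (fact n))
      by (symmetry; exact (is_derive_unique _ _ _ HT)).
    ring.
Qed.

(** The Gamma density is at most its polynomial factor; integrate from [0]. *)
Lemma poisson_tail_lt (n : nat) (s : R) : 0 < s ->
  poisson_tail n s < s ^ S n / INR (fact (S n)).
Proof.
  intros Hs.
  enough (0 - 0 < s ^ S n / INR (fact (S n)) - poisson_tail n s) by lra.
  replace (0 - 0) with (0 ^ S n / INR (fact (S n)) - poisson_tail n 0).
  2:{ unfold poisson_tail. rewrite exp_taylor_at_0, Ropp_0, exp_0. simpl.
      unfold Rdiv. ring. }
  apply (lt_of_derive_pos (fun x => x ^ S n / INR (fact (S n)) - poisson_tail n x)
           (fun x => x ^ n / INR (fact n) - x ^ n / INR (fact n) * exp (- x))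
           0 s Hs).
  - intros x _. apply (is_derive_minus (V := R_NormedModule));
      [apply is_derive_monomial | apply is_derive_poisson_tail].
  - intros x Hx.
    assert (0 < x ^ n / INR (fact n))
      by (apply Rdiv_lt_0_compat; [apply pow_lt; lra | apply INR_fact_pos]).
    assert (exp (- x) < 1) by (rewrite <- exp_0; apply exp_increasing; lra).
    nra.
Qed.

Lemma tail_quotient_lt (n : nat) (s : R) : 0 < s ->
  tail_quotient n s < exp s / INR (fact (S n)).
Proof.
  intros Hs. pose proof (poisson_tail_lt n s Hs) as H.
  pose proof (INR_fact_pos (S n)) as Hf.
  assert (Hp : 0 < s ^ S n) by now apply pow_lt.
  rewrite poisson_tailE, exp_Ropp in H.
  pose proof (exp_pos s) as He.
  unfold tail_quotient. replace (n + 1)%nat with (S n) by lia.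
  apply (Rmult_lt_reg_r (s ^ S n / exp s)); [now apply Rdiv_lt_0_compat|].
  replace (exp_tail n s / s ^ S n * (s ^ S n / exp s))
    with (exp_tail n s * / exp s) by (field; lra).
  replace (exp s / INR (fact (S n)) * (s ^ S n / exp s))
    with (s ^ S n / INR (fact (S n))) by (field; lra).
  exact H.
Qed.

Lemma tail_quotient_gt (n : nat) (s : R) : 0 < s ->
  s / INR (fact (S (S n))) < tail_quotient n s.
Proof.
  intros Hs.
  pose proof (INR_fact_pos (S n)) as Hf.
  pose proof (INR_fact_pos (S (S n))) as Hf2.
  assert (Hp : 0 < s ^ S n) by now apply pow_lt.
  pose proof (exp_tail_pos (S (S n)) s Hs) as HR.
  assert (0 < s ^ S n / INR (fact (S n))) by now apply Rdiv_lt_0_compat.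
  unfold tail_quotient. replace (n + 1)%nat with (S n) by lia.
  apply (Rmult_lt_reg_r (s ^ S n)); [exact Hp|].
  replace (exp_tail n s / s ^ S n * s ^ S n) with (exp_tail n s)
    by (field; lra).
  rewrite (exp_tail_S n), (exp_tail_S (S n)).
  replace (s / INR (fact (S (S n))) * s ^ S n)
    with (s ^ S (S n) / INR (fact (S (S n))))
    by (simpl pow; field; lra).
  lra.
Qed.

Lemma is_s_iff (n : nat) (d s : R) : 0 < d ->
  is_s n d s <-> 0 < s /\ tail_quotient n s = / (d * INR (fact n)).
Proof.
  intros Hd. pose proof (INR_fact_pos n) as Hf.
  unfold is_s, tail_quotient, exp_tail.
  split; intros [Hs H]; (split; [exact Hs|]);
    assert (Hp : 0 < s ^ (n + 1)) by now apply pow_lt.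
  - rewrite H. field. lra.
  - replace (exp s) with
      (exp_taylor n s + (exp s - exp_taylor n s) / s ^ (n + 1) * s ^ (n + 1))
      by (field; lra).
    rewrite H. field. lra.
Qed.

Lemma is_s_exists (n : nat) (d : R) :
  0 < d < INR n + 1 -> exists s, is_s n d s.
Proof.
  intros [Hd Hdn]. pose proof (INR_fact_pos n) as Hf.
  pose proof (pos_INR n) as Hn.
  set (v := / (d * INR (fact n))).
  (* The limit of [tail_quotient n] at [0] is [/ (n + 1)!], and [a] is such
     that the bound [exp a / (n + 1)!] is still below the level [v]. *)
  set (a := ln ((INR n + 1) / d) / 2).
  (* At [b] the linear lower bound [b / (n + 2)!] equals [v]. *)
  set (b := (INR n + 1) * (INR n + 2) / d).
  assert (Hrat : 1 < (INR n + 1) / d)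
    by (apply (Rmult_lt_reg_r d); [lra | field_simplify; lra]).
  assert (Hln : 0 < ln ((INR n + 1) / d))
    by (rewrite <- ln_1; apply ln_increasing; lra).
  assert (Ha : 0 < a) by (unfold a; lra).
  assert (Hb : 0 < b) by (apply Rdiv_lt_0_compat; nra).
  assert (Hqa : tail_quotient n a < v).
  { apply Rlt_trans with (1 := tail_quotient_lt n a Ha).
    assert (He : exp a < (INR n + 1) / d).
    { rewrite <- (exp_ln ((INR n + 1) / d)) by lra.
      apply exp_increasing. unfold a. lra. }
    unfold v. rewrite INR_fact_S.
    replace (/ (d * INR (fact n)))
      with ((INR n + 1) / d / ((INR n + 1) * INR (fact n))) by (field; lra).
    apply Rmult_lt_compat_r; [apply Rinv_0_lt_compat; nra | exact He]. }
  assert (Hqb : v < tail_quotient n b).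
  { pose proof (tail_quotient_gt n b Hb) as H.
    replace (b / INR (fact (S (S n)))) with v in H; [exact H|].
    unfold v, b. rewrite !INR_fact_S, S_INR. field. lra. }
  assert (Hab : a < b).
  { destruct (Rtotal_order a b) as [H | [H | H]]; [exact H | |].
    - rewrite H in Hqa. lra.
    - pose proof (tail_quotient_increasing n b a Hb H). lra. }
  destruct (IVT_interv (fun x => tail_quotient n x - v) a b) as [s [Hsab Hs]];
    [ | exact Hab | lra | lra | ].
  - intros x Hx. apply continuity_pt_minus.
    + apply derivable_continuous_pt. eexists. apply is_derive_Reals.
      apply is_derive_tail_quotient. lra.
    + apply continuity_pt_const. now intros ? ?.
  - exists s. apply is_s_iff; [exact Hd|]. fold v. lra.
Qed.

Lemma is_s_unique (n : nat) (d s t : R) :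
  0 < d -> is_s n d s -> is_s n d t -> s = t.
Proof.
  intros Hd Hs Ht.
  apply (is_s_iff n d s Hd) in Hs. apply (is_s_iff n d t Hd) in Ht.
  destruct Hs as [Hs Es], Ht as [Ht Et].
  destruct (Rtotal_order s t) as [H | [H | H]]; [ | exact H | ].
  - pose proof (tail_quotient_increasing n s t Hs H). lra.
  - pose proof (tail_quotient_increasing n t s Ht H). lra.
Qed.

Lemma s_correct (n : nat) (d : R) : 0 < d < INR n + 1 -> is_s n d (s_ n d).
Proof.
  intros Hd. unfold s_. apply (iota_correct (is_s n d)).
  destruct (is_s_exists n d Hd) as [s Hs].
  exists s. split; [exact Hs|].
  intros t Ht. apply (is_s_unique n d); [lra | exact Hs | exact Ht].
Qed.

Lemma s_pos (n : nat) (d : R) : 0 < d < INR n + 1 -> 0 < s_ n d.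
Proof. intros Hd. exact (proj1 (s_correct n d Hd)). Qed.

Lemma tail_quotient_s (n : nat) (d : R) : 0 < d < INR n + 1 ->
  tail_quotient n (s_ n d) = / (d * INR (fact n)).
Proof.
  intros Hd. apply is_s_iff; [lra|]. now apply s_correct.
Qed.

(** Because [tail_quotient n] is increasing, the position of a point relative
    to [s_ n d], known only through its equation, becomes an inequality
    between explicit functions of [d] and the point.  Both the continuity of
    [s_ n] and the sign of the derivative of [ln (E n d)] are read off from
    this lemma and its mirror image. *)
Lemma s_lt_iff (n : nat) (d t : R) : 0 < d < INR n + 1 -> 0 < t ->
  s_ n d < t <-> / (d * INR (fact n)) < tail_quotient n t.
Proof.
  intros Hd Ht. rewrite <- (tail_quotient_s n d Hd).
  pose proof (s_pos n d Hd) as Hs. split; intros H.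
  - now apply tail_quotient_increasing.
  - destruct (Rtotal_order (s_ n d) t) as [H1 | [H1 | H1]]; [exact H1 | |].
    + rewrite H1 in H. lra.
    + pose proof (tail_quotient_increasing n t (s_ n d) Ht H1). lra.
Qed.

Lemma s_gt_iff (n : nat) (d t : R) : 0 < d < INR n + 1 -> 0 < t ->
  t < s_ n d <-> tail_quotient n t < / (d * INR (fact n)).
Proof.
  intros Hd Ht. rewrite <- (tail_quotient_s n d Hd).
  pose proof (s_pos n d Hd) as Hs. split; intros H.
  - now apply tail_quotient_increasing.
  - destruct (Rtotal_order (s_ n d) t) as [H1 | [H1 | H1]]; [ | | exact H1].
    + pose proof (tail_quotient_increasing n (s_ n d) t Hs H1). lra.
    + rewrite H1 in H. lra.
Qed.

Lemma locally_admissible (n : nat) (d : R) : 0 < d < INR n + 1 ->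
  locally d (fun e => 0 < e < INR n + 1).
Proof.
  intros [H1 H2].
  exact (filter_and _ _ (open_gt 0 d H1) (open_lt (INR n + 1) d H2)).
Qed.

(** By the two comparisons above, each strict bound on [s_ n d] is a strict
    bound on the continuous level [/ (d * n!)], hence persists near [d]. *)
Lemma continuous_s (n : nat) (d : R) : 0 < d < INR n + 1 ->
  continuous (s_ n) d.
Proof.
  intros Hd. pose proof (s_pos n d Hd) as Hs.
  pose proof (INR_fact_pos n) as Hf.
  assert (Hc : continuous (fun e => / (e * INR (fact n))) d).
  { apply (ex_derive_continuous (V := R_NormedModule)). auto_derive. nra. }
  apply filterlim_locally. intros [eps Heps]. simpl.
  (* The lower test point has to stay positive. *)
  set (l := Rmax (s_ n d - eps) (s_ n d / 2)).
  assert (Hl : 0 < l) by (apply Rlt_le_trans with (2 := Rmax_r _ _); lra).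
  assert (Hls : l < s_ n d) by (apply Rmax_lub_lt; lra).
  assert (Hu : 0 < s_ n d + eps) by lra.
  assert (Hus : s_ n d < s_ n d + eps) by lra.
  pose proof (proj1 (s_gt_iff n d l Hd Hl) Hls) as Ql.
  pose proof (proj1 (s_lt_iff n d _ Hd Hu) Hus) as Qu.
  generalize (filter_and _ _ (locally_admissible n d Hd)
    (filter_and _ _ (Hc _ (open_gt _ _ Ql)) (Hc _ (open_lt _ _ Qu)))).
  apply filter_imp. intros e [He [H1 H2]].
  apply (s_gt_iff n e l He Hl) in H1.
  apply (s_lt_iff n e _ He Hu) in H2.
  pose proof (Rmax_l (s_ n d - eps) (s_ n d / 2)) as Hmax. fold l in Hmax.
  apply Rabs_def1; unfold minus, plus, opp; simpl; lra.
Qed.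

(** * The maximum and its derivative *)

Definition ln_E (n : nat) (d s : R) : R := ln (poisson_tail n s) - d * ln s.

Lemma E_eq_exp (n : nat) (d s : R) : 0 < s -> E n d s = exp (ln_E n d s).
Proof.
  intros Hs. unfold E, ln_E. destruct (Rlt_dec 0 s) as [_ | H]; [|lra].
  fold (poisson_tail n s).
  unfold Rminus. rewrite exp_plus, exp_Ropp, exp_ln by now apply poisson_tail_pos.
  reflexivity.
Qed.

Lemma is_derive_ln_E (n : nat) (d s : R) : 0 < s ->
  is_derive (ln_E n d) s
    ((/ (INR (fact n) * tail_quotient n s) - d) / s).
Proof.
  intros Hs. pose proof (poisson_tail_pos n s Hs) as HG.
  pose proof (is_derive_poisson_tail n s) as HD.
  pose proof (exp_tail_pos n s Hs) as HR.
  pose proof (INR_fact_pos n) as Hf. pose proof (exp_pos (- s)) as He.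
  assert (Hp : 0 < s ^ n) by now apply pow_lt.
  unfold ln_E. auto_derive.
  - repeat split; [eexists; exact HD | exact HG | exact Hs].
  - replace (Derive _ s) with (s ^ n / INR (fact n) * exp (- s))
      by (symmetry; exact (is_derive_unique _ _ _ HD)).
    rewrite poisson_tailE. unfold tail_quotient. rewrite pow_add. simpl.
    field. repeat split; lra.
Qed.

(** [ln_E n d] increases before [s_ n d] and decreases after it, because its
    derivative has the sign of [/ (d * n!) - tail_quotient n s]. *)
Lemma ln_E_le_max (n : nat) (d s : R) : 0 < d < INR n + 1 -> 0 < s ->
  ln_E n d s <= ln_E n d (s_ n d).
Proof.
  intros Hd Hs. pose proof (s_pos n d Hd) as Hs0.
  pose proof (INR_fact_pos n) as Hf.
  assert (Hq : forall x, 0 < x -> 0 < tail_quotient n x).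
  { intros x Hx. apply Rdiv_lt_0_compat;
      [now apply exp_tail_pos | now apply pow_lt]. }
  assert (Hinv : / (INR (fact n) * / (d * INR (fact n))) = d)
    by (field; lra).
  assert (Hlevel : 0 < / (d * INR (fact n)))
    by (rewrite <- (tail_quotient_s n d Hd); now apply Hq).
  destruct (Rtotal_order s (s_ n d)) as [H | [H | H]].
  - apply Rlt_le.
    apply (lt_of_derive_pos (ln_E n d) _ s (s_ n d) H
             (fun x Hx =>
                is_derive_ln_E n d x (Rlt_le_trans _ _ _ Hs (proj1 Hx)))).
    intros x Hx. pose proof (Hq x ltac:(lra)) as Hqx.
    destruct Hx as [Hx1 Hx2].
    apply (s_gt_iff n d x Hd ltac:(lra)) in Hx2.
    apply Rdiv_lt_0_compat; [|lra].
    enough (/ (INR (fact n) * / (d * INR (fact n)))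
            < / (INR (fact n) * tail_quotient n x)) by lra.
    apply Rinv_lt_contravar; [|now apply Rmult_lt_compat_l].
    now apply Rmult_lt_0_compat; apply Rmult_lt_0_compat.
  - rewrite H. apply Rle_refl.
  - enough (- ln_E n d (s_ n d) < - ln_E n d s) by lra.
    apply (lt_of_derive_pos (fun x => - ln_E n d x) _ (s_ n d) s H
             (fun x Hx => is_derive_opp (V := R_NormedModule) _ _ _
               (is_derive_ln_E n d x (Rlt_le_trans _ _ _ Hs0 (proj1 Hx))))).
    intros x [Hx1 _]. assert (Hx : 0 < x) by lra.
    pose proof (Hq x Hx) as Hqx.
    apply (s_lt_iff n d x Hd Hx) in Hx1.
    change (0 < - ((/ (INR (fact n) * tail_quotient n x) - d) / x)).
    replace (- _) with ((d - / (INR (fact n) * tail_quotient n x)) / x)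
      by (field; lra).
    apply Rdiv_lt_0_compat; [|lra].
    enough (/ (INR (fact n) * tail_quotient n x)
            < / (INR (fact n) * / (d * INR (fact n)))) by lra.
    apply Rinv_lt_contravar; [|now apply Rmult_lt_compat_l].
    now apply Rmult_lt_0_compat; apply Rmult_lt_0_compat.
Qed.

Lemma is_max_E_s (n : nat) (d : R) : 0 < d < INR n + 1 ->
  is_max_E n d (E n d (s_ n d)).
Proof.
  intros Hd. pose proof (s_pos n d Hd) as Hs0. split.
  - exists (s_ n d). split; [lra | reflexivity].
  - intros s [Hs | <-]; rewrite (E_eq_exp n d (s_ n d) Hs0).
    + rewrite (E_eq_exp n d s Hs).
      destruct (ln_E_le_max n d s Hd Hs) as [H | H].
      * apply Rlt_le, exp_increasing, H.
      * rewrite H. apply Rle_refl.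
    + unfold E. destruct (Rlt_dec 0 0) as [H | _]; [lra|].
      apply Rlt_le, exp_pos.
Qed.

Lemma ln_ME (n : nat) (d : R) : 0 < d < INR n + 1 ->
  ln (ME n d) = ln_E n d (s_ n d).
Proof.
  intros Hd. pose proof (is_max_E_s n d Hd) as Hmax.
  replace (ME n d) with (E n d (s_ n d)).
  - rewrite (E_eq_exp n d _ (s_pos n d Hd)). apply ln_exp.
  - symmetry. unfold ME.
    apply (iota_unique (V := R_CompleteNormedModule)); [|exact Hmax].
    intros m [[s [Hs <-]] Hm]. destruct Hmax as [[t [Ht Et]] Hle].
    apply Rle_antisym; [now apply Hle | rewrite <- Et; now apply Hm].
Qed.

(** Supremum of functions affine in [d]: the one attained at [d] stays below
    the supremum at [e]. *)
Lemma ln_ME_tangent (n : nat) (d e : R) :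
  0 < d < INR n + 1 -> 0 < e < INR n + 1 ->
  ln (ME n d) - (e - d) * ln (s_ n d) <= ln (ME n e).
Proof.
  intros Hd He. rewrite (ln_ME n d Hd), (ln_ME n e He).
  apply Rle_trans with (2 := ln_E_le_max n e (s_ n d) He (s_pos n d Hd)).
  unfold ln_E. lra.
Qed.

Theorem proposition10 (n : nat) (delta : R)
  (Hdelta : 0 < delta < INR n + 1) :
  is_derive (fun d : R => ln (ME n d)) delta (- ln (s_ n delta)).
Proof.
  apply is_derive_Reals. intros eps Heps.
  assert (Hc : continuous (fun d => ln (s_ n d)) delta).
  { apply (continuous_comp (s_ n) ln); [now apply continuous_s|].
    apply continuous_ln, s_pos, Hdelta. }
  destruct (filter_and _ _ (locally_admissible n delta Hdelta)
              (proj1 (filterlim_locally _ _) Hc (mkposreal eps Heps)))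
    as [r Hr].
  exists r. intros h Hh Hhr.
  destruct (Hr (delta + h)) as [He Hball].
  { unfold ball; simpl; unfold AbsRing_ball, abs, minus, plus, opp; simpl.
    now replace (delta + h + - delta) with h by ring. }
  unfold ball in Hball; simpl in Hball.
  unfold AbsRing_ball, abs, minus, plus, opp in Hball; simpl in Hball.
  apply Rle_lt_trans with (2 := Hball).
  pose proof (ln_ME_tangent n delta (delta + h) Hdelta He) as H1.
  pose proof (ln_ME_tangent n (delta + h) delta He Hdelta) as H2.
  set (u := ln (s_ n delta)) in *. set (v := ln (s_ n (delta + h))) in *.
  set (D := ln (ME n (delta + h)) - ln (ME n delta)).
  (* The tangents at [delta] and at [delta + h] squeeze the error of the linear
     approximation, for either sign of [h]. *)
  assert (HD : 0 <= D + h * u <= h * (u - v)) by (unfold D; lra).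
  replace (D / h - - u) with ((D + h * u) / h) by (field; exact Hh).
  unfold Rdiv. rewrite Rabs_mult, Rabs_inv.
  assert (Hh' : 0 < Rabs h) by now apply Rabs_pos_lt.
  apply (Rmult_le_reg_r (Rabs h)); [exact Hh'|].
  rewrite Rmult_assoc, Rinv_l, Rmult_1_r by lra.
  rewrite <- Rabs_mult, (Rabs_pos_eq (D + h * u)) by lra.
  apply Rle_trans with (1 := proj2 HD).
  replace (h * (u - v)) with (- ((v + - u) * h)) by ring.
  rewrite <- Rabs_Ropp. apply Rle_abs.
Qed.
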